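(* Let $\mu \in \mathbb{R}$, $\sigma > 0$, $r > 0$, and suppose $X \sim \mathrm{GLN}(\mu,\sigma,r)$. Then: (1) The moment-generating function of $X$ does not exist, for any $r \in (0,\infty)$; that is, there is no $t_0 > 0$ such that $\mathbb{E}[e^{tX}] < \infty$ for all $|t| < t_0$. (2) For real $k$, the $k$th moment $\mathbb{E}[X^k]$ exists (i.e. is finite) if and only if - $k = 0$, in the case $r < 1$; - $|k| < 1/\sigma$, in the case $r = 1$; - $k \in (-\infty,\infty)$ (i.e. no restriction on $k$), in the case $r > 1$.
   Context: For $\mu \in \mathbb{R}$, $\sigma > 0$, $r > 0$, the generalized lognormal distribution $\mathrm{GLN}(\mu,\sigma,r)$ is the probability distribution on $(0,\infty)$ with density $$f(x) = \frac{1}{2\, x\, r^{1/r}\, \sigma\, \Gamma(1+1/r)} \exp\left\{ -\frac{1}{r\,\sigma^r} |\ln x - \mu|^r \right\}, \quad 0 < x < \infty.$$ The moment-generating function of $X$ is said to exist if $\mathbb{E}[e^{tX}]$ is finite for all $|t| < t_0$, for some $t_0 > 0$. Moments of arbitrary real (in particular fractional or negative) order $k$ are considered, since $X > 0$ almost surely. *)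

(* Defs.v *)
From HB Require Import structures.
From mathcomp Require Import all_boot all_order all_algebra.
From mathcomp Require Import all_classical all_reals all_analysis.

Set Implicit Arguments.
Unset Strict Implicit.
Unset Printing Implicit Defensive.

Import Order.TTheory GRing.Theory Num.Theory.
Import numFieldNormedType.Exports.

Local Open Scope classical_set_scope.
Local Open Scope ring_scope.

(* Euler's integral; meaningful for 0 < a only, since Rintegral maps a
   divergent integral to 0. *)
Definition Gamma (R : realType) (a : R) : R :=
  \int[@lebesgue_measure R]_(x in `]0, +oo[) (x `^ (a - 1) * expR (- x)).

Definition gln_pdf (R : realType) (mu sigma r x : R) : R :=
  if 0 < x then
    1 / (2 * x * r `^ (1 / r) * sigma * Gamma (1 + 1 / r))
    * expR (- (1 / (r * sigma `^ r)) * `|ln x - mu| `^ r)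
  else 0.

Definition gln_prob (R : realType) (mu sigma r : R) (A : set R) : \bar R :=
  (\int[lebesgue_measure]_(x in A) (gln_pdf mu sigma r x)%:E)%E.

Definition has_gln_distribution d (T : measurableType d) (R : realType)
    (P : probability T R) (X : {RV P >-> R}) (mu sigma r : R) : Prop :=
  forall A : set R, measurable A -> distribution P X A = gln_prob mu sigma r A.

Definition mgf_exists d (T : measurableType d) (R : realType)
    (P : probability T R) (X : {RV P >-> R}) : Prop :=
  exists2 t0 : R, 0 < t0 &
    forall t : R, `|t| < t0 -> 'M_P X t \is a fin_num.

(* The convention for `^ at a nonpositive base is immaterial when X is almost
   surely positive. As _ `^ _ is nonnegative, the expectation is always defined
   in [0, +oo], and its finiteness is the integrability of X ^ k. *)
Definition moment_exists d (T : measurableType d) (R : realType)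
    (P : probability T R) (X : {RV P >-> R}) (k : R) : Prop :=
  ('E_P[fun w => (X w `^ k)%R])%E \is a fin_num.

(* Main.v *)
(** In the variable [y = ln x] the density is a constant times
    [x^-1 * exp (- b * |y - mu|^r)], with [b = 1 / (r * sigma^r)], so that
    [E[X^k]] is a constant times the integral of [exp (k y - b |y - mu|^r)]
    against [dx / x = dy].  If [r > 1], or [r = 1] and [|k| < b], the exponent
    is at most [C - c |y|] and the integral converges.  If [r < 1] and
    [k <> 0], or [r = 1] and [b <= |k|], the exponent is bounded below on the
    half-line [0 <= k y] and the integral diverges.  The same happens to
    [t e^y - b |y - mu|^r] on [0 <= y] for every [t > 0], since
    [|y - mu|^r = O(e^(y/2))]. *)
Require Import Defs.
From HB Require Import structures.
From mathcomp Require Import all_boot all_order all_algebra.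
From mathcomp Require Import all_classical all_reals all_analysis.
From mathcomp Require Import measurable_realfun ring lra.

Set Implicit Arguments.
Unset Strict Implicit.
Unset Printing Implicit Defensive.

Import Order.TTheory GRing.Theory Num.Theory.
Import numFieldNormedType.Exports.
Import HBNNSimple.

Local Open Scope classical_set_scope.
Local Open Scope ring_scope.

(** * Integration against a measure with a density *)

(** Monotone approximation by simple functions and linearity reduce the claim to indicators, where
    it is the hypothesis on [nu]. *)
Lemma ge0_integral_density (d : measure_display) (T : measurableType d)
    (R : realType) (nu m : {measure set T -> \bar R}) (p : T -> R) :
  measurable_fun [set: T] p -> (forall x, 0 <= p x) ->
  (forall A, measurable A -> nu A = \int[m]_(x in A) (p x)%:E)%E ->
  forall f : T -> \bar R, measurable_fun [set: T] f -> (forall x, 0 <= f x)%E ->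
  (\int[nu]_x f x = \int[m]_x (f x * (p x)%:E))%E.
Proof.
move=> mp p0 nuE f mf f0.
have mpE : measurable_fun [set: T] (EFin \o p) by exact/measurable_EFinP.
pose h := nnsfun_approx measurableT mf.
have hcvg x : (h n x)%:E @[n --> \oo] --> f x.
  by apply: cvg_nnsfun_approx => // y _; exact: f0.
have hnd x : {homo (fun n => h n x) : m n / (m <= n)%N >-> m <= n}.
  by move=> i j ij; exact/lefP/nd_nnsfun_approx.
have mh n : measurable_fun [set: T] (EFin \o h n) by exact/measurable_EFinP.
have -> : (\int[nu]_x f x = lim (\int[nu]_x (h n x)%:E @[n --> \oo]))%E.
  rewrite -monotone_convergence//.
  - by apply: eq_integral => x _; apply/esym/cvg_lim.
  - by move=> n x _; rewrite lee_fin.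
  - by move=> x _ i j ij; rewrite lee_fin hnd.
have -> : (\int[m]_x (f x * (p x)%:E) =
    lim (\int[m]_x ((h n x)%:E * (p x)%:E) @[n --> \oo]))%E.
  rewrite -monotone_convergence//.
  - by apply: eq_integral => x _; apply/esym/cvg_lim => //; exact: cvgeZr.
  - by move=> n; exact: (@emeasurable_funM _ _ _ _ (EFin \o h n) (EFin \o p)).
  - by move=> n x _; rewrite mule_ge0// lee_fin.
  - by move=> x _ i j ij; rewrite lee_wpmul2r ?lee_fin// hnd.
apply: congr_lim; apply/funext => n /=.
rewrite integralT_nnsfun sintegralE.
(* The simple function is split over its fibres, so that the finite sum can leave the integral. *)
transitivity (\int[m]_x (\sum_(y \in range (h n))
    (y * \1_(h n @^-1` [set y]) x)%:E * (p x)%:E))%E; last first.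
  apply: eq_integral => x _; rewrite -ge0_mule_fsuml.
    by rewrite fsumEFin// -fimfunE.
  by move=> y; exact: nnfun_muleindic_ge0.
have mhp y : measurable_fun [set: T]
    (fun x => (\1_(h n @^-1` [set y]) x)%:E * (p x)%:E)%E.
  apply: (@emeasurable_funM _ _ _ _ (EFin \o \1_(h n @^-1` [set y]))
    (EFin \o p)) => //.
  exact/measurable_EFinP.
rewrite ge0_integral_fsum//; first last.
- move=> y x _; rewrite mule_ge0 ?lee_fin//; exact: nnfun_muleindic_ge0.
- move=> y; under eq_fun do rewrite EFinM -muleA.
  exact: measurable_funeM.
apply: eq_fsbigr => y /[!inE] -[x _ <-].
under eq_integral do rewrite EFinM -muleA.
rewrite ge0_integralZl//; last 2 first.
- by move=> z _; rewrite mule_ge0 ?lee_fin.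
- by rewrite lee_fin.
congr (_ * _)%E; rewrite nuE//.
rewrite -[in LHS](setTI (_ @^-1` _)) integral_mkcondr.
apply: eq_integral => z _.
by rewrite epatch_indic muleC.
Qed.

(** * The substitution [y = ln x] *)

Lemma within_continuous_inv_comp_ln (R : realType) (psi : R -> R) (a b : R) :
  0 < a -> continuous psi ->
  {within `[a, b], continuous (fun x : R => x^-1 * psi (ln x))}.
Proof.
move=> a0 cpsi; apply/continuous_in_subspaceT => x.
rewrite inE/= in_itv/= => /andP[ax _].
have x0 : 0 < x by exact: lt_le_trans ax.
apply: cvgM; first by apply: cvgV; [rewrite gt_eqF|exact: cvg_id].
by apply: continuous_comp; [exact: continuous_ln|exact: cpsi].
Qed.

(** The fundamental theorem of calculus for [phi \o ln]; afterwards only antiderivatives in the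
    variable [y = ln x] are needed. *)
Lemma integral_inv_comp_ln (R : realType) (phi dphi : R -> R) (a b : R) :
  0 < a -> a < b ->
  (forall y : R, is_derive y 1 phi (dphi y)) -> continuous dphi ->
  (\int[lebesgue_measure]_(x in `[a, b]) (x^-1 * dphi (ln x))%:E
    = (phi (ln b) - phi (ln a))%:E)%E.
Proof.
move=> a0 ab phiE cdphi.
have dF (x : R) : 0 < x -> is_derive x 1 (phi \o @ln R) (x^-1 * dphi (ln x)).
  move=> x0; have ? := is_derive1_ln x0.
  by rewrite mulrC; exact: is_derive1_comp.
have cF (x : R) : 0 < x -> {for x, continuous (phi \o @ln R)}.
  by move=> /dF dFx; apply/differentiable_continuous/derivable1_diffP.
rewrite EFinB (@continuous_FTC2 _ _ (phi \o @ln R))//.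
- exact: within_continuous_inv_comp_ln.
- split.
  + move=> x; rewrite in_itv/= => /andP[ax _].
    by have := dF x (lt_trans a0 ax) => -[].
  + by apply: cvg_at_right_filter; exact: cF.
  + by apply: cvg_at_left_filter; apply: cF; exact: lt_trans ab.
- move=> x; rewrite in_itv/= => /andP[ax _].
  by rewrite derive1E; have [_ ->] := dF x (lt_trans a0 ax).
Qed.

(** [e / x] has infinite integral both near 0 and near infinity; the sign of [s] selects the end, so
    that positive and negative orders of moments are treated together. *)
Lemma integral_ge_inv_infty (R : realType) (s e : R) (g : R -> R) :
  s != 0 -> 0 < e -> measurable_fun [set: R] g -> (forall x, 0 <= g x) ->
  (forall x, 0 < x -> 0 <= s * ln x -> e * x^-1 <= g x) ->
  (\int[lebesgue_measure]_x (g x)%:E = +oo)%E.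
Proof.
move=> s0 e0 mg g0 eg.
have H u v : u < v -> 0 <= s * u -> 0 <= s * v ->
    (((v - u) * e)%:E <= \int[lebesgue_measure]_x (g x)%:E)%E.
  move=> uv su sv.
  have euv : expR u < expR v by rewrite ltr_expR.
  have phiE (y : R) : is_derive y 1 (fun z : R => e * z) e.
    by apply: (is_derive_eq (is_deriveZ _ _)); rewrite /GRing.scale/= mulr1.
  have := @integral_inv_comp_ln _ _ (fun=> e) _ _ (expR_gt0 u) euv phiE
    (fun x => cvg_cst e).
  rewrite !expRK -mulrBr mulrC => <-.
  apply: (@le_trans _ _
    (\int[lebesgue_measure]_(x in `[expR u, expR v]) (g x)%:E)%E).
    apply: ge0_le_integral => //=.
    - move=> x; rewrite in_itv/= => /andP[ux _].
      by rewrite lee_fin mulr_ge0 ?invr_ge0 ?ltW// (lt_le_trans _ ux) ?expR_gt0.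
    - apply/measurable_EFinP.
      apply: subspace_continuous_measurable_fun => //.
      apply: (@within_continuous_inv_comp_ln _ (fun=> e)); first exact: expR_gt0.
      by move=> ?; exact: cvg_cst.
    - exact/measurable_EFinP/measurable_funTS.
    - move=> x; rewrite in_itv/= => /andP[ux xv].
      have x0 : 0 < x by rewrite (lt_le_trans _ ux) ?expR_gt0.
      rewrite lee_fin mulrC eg//.
      have ulnx : u <= ln x by rewrite -ler_expR lnK.
      have lnxv : ln x <= v by rewrite -ler_expR lnK.
      (* [s * ln x] is monotone in [ln x]: its sign is inherited from the end [u] if [0 < s], and
         from [v] otherwise. *)
      have [s_gt0|] := ltP 0 s.
        by apply: le_trans su _; rewrite ler_pM2l.
      by move=> s_le0; apply: le_trans sv _; rewrite ler_wnM2l.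
  apply: ge0_subset_integral => //.
  - exact/measurable_EFinP.
  - by move=> x _; rewrite lee_fin.
apply/eqyP => A A0.
(* Logarithmic length [A / e], on the side of [ln x = 0] given by the sign of [s], contributes at
   least [A]. *)
have Ae : 0 < A / e by rewrite divr_gt0.
have [s_gt0|s_lt0|/eqP] := ltgtP 0 s; last by rewrite eq_sym (negbTE s0).
- have := H 0 (A / e) Ae; rewrite subr0 divfK ?gt_eqF//.
  by apply; rewrite ?mulr0// mulr_ge0// ltW.
- have := H (- (A / e)) 0; rewrite sub0r opprK divfK ?gt_eqF//.
  apply; rewrite ?mulr0 ?oppr_lt0//.
  by rewrite mulrN -mulNr mulr_ge0 ?oppr_ge0 ?ltW.
Qed.

Lemma integral_le_exp_lt_infty (R : realType) (c M : R) (f : R -> R) :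
  0 < c -> measurable_fun [set: R] f -> (forall x, 0 <= f x) ->
  (forall x, x <= 0 -> f x = 0) ->
  (forall x, 0 < x -> f x <= M * (x^-1 * expR (- (c * `|ln x|)))) ->
  (\int[lebesgue_measure]_x (f x)%:E < +oo)%E.
Proof.
move=> c0 mf f0 fN fM.
have M0 : 0 <= M.
  have := le_trans (f0 1) (fM 1 ltr01).
  by rewrite ln1 normr0 mulr0 oppr0 expR0 invr1 !mulr1.
(* A smooth majorant of [exp (- c |y|)] with bounded antiderivative: with
   [w = exp (c y)], [4 w / (1 + w)^2] is the derivative of
   [- (4 / c) / (1 + w)]. *)
pose phi (y : R) : R := - (4 * M / c) * (1 + expR (c * y))^-1.
pose dphi (y : R) : R := 4 * M * (expR (c * y) / (1 + expR (c * y)) ^+ 2).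
have w0 y : 0 < 1 + expR (c * y) :> R by rewrite addr_gt0 ?expR_gt0.
have phiE (y : R) : is_derive y 1 phi (dphi y).
  have dc : is_derive y 1 (fun z : R => c * z) c.
    by apply: (is_derive_eq (is_deriveZ _ _)); rewrite /GRing.scale/= mulr1.
  have de : is_derive y 1 (fun z : R => 1 + expR (c * z)) (c * expR (c * y)).
    apply: (is_derive_eq (is_deriveD (is_derive_cst _ _ _)
      (is_derive1_comp (is_derive_expR _) dc))).
    by rewrite add0r mulrC.
  have dv := @is_deriveV _ (fun z : R => 1 + expR (c * z)) _ _ _
    (lt0r_neq0 (w0 y)) de.
  apply: (is_derive_eq (is_deriveZ _ dv)).
  rewrite /dphi /GRing.scale/=; field; rewrite gt_eqF//= gt_eqF//.
have cdphi : continuous dphi.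
  move=> y; have ce : {for y, continuous (fun z : R => expR (c * z))}.
    apply: continuous_comp; last exact: continuous_expR.
    exact: mulrl_continuous.
  apply: cvgM; first exact: cvg_cst.
  apply: cvgM; first exact: ce.
  apply: cvgV; first by rewrite gt_eqF// exprn_gt0.
  by apply: cvgM; apply: cvgD => //; exact: cvg_cst.
(* With [w = exp (c y)], this is [(1 + w)^2 <= 4 w^2] for [1 <= w], and [(1 + w)^2 <= 4] for
   [w <= 1]. *)
have Hdphi y : M * expR (- (c * `|y|)) <= dphi y.
  rewrite /dphi [4 * M]mulrC -mulrA ler_wpM2l//.
  rewrite mulrA ler_pdivlMr ?exprn_gt0//.
  have [y0|y0] := leP 0 y.
    have w1 : 1 <= expR (c * y) by rewrite -expR0 ler_expR mulr_ge0// ltW.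
    rewrite ger0_norm// expRN mulrC ler_pdivrMr ?expR_gt0//.
    by nra.
  have w1 : expR (c * y) <= 1 by rewrite -expR0 ler_expR nmulr_lle0// ltW.
  have := expR_gt0 (c * y).
  by rewrite ltr0_norm// mulrN opprK; nra.
(* Compact intervals exhausting []0, +oo[]: the antiderivative is evaluated on each, and the bound
   [4 M / c] does not depend on [n]. *)
pose F (n : nat) : set R := `[expR (- n.+1%:R), expR n.+1%:R]%classic.
have mF n : measurable (F n) by exact: measurable_itv.
have FE : \bigcup_n F n = `]0, +oo[%classic.
  apply/seteqP; split => x.
    move=> [n _]; rewrite /F/= !in_itv/= andbT => /andP[+ _].
    by apply: lt_le_trans; exact: expR_gt0.
  rewrite /= in_itv/= andbT => x0.
  have := ltW (truncnS_gt `|ln x|); set n := Num.truncn _.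
  rewrite ler_norml => /andP[h1 h2]; exists n => //=.
  by rewrite /F/= in_itv/= -[x in _ <= x <= _]lnK// !ler_expR h1.
have -> : (\int[lebesgue_measure]_x (f x)%:E =
    \int[lebesgue_measure]_(x in \bigcup_n F n) (f x)%:E)%E.
  rewrite FE [RHS]integral_mkcond; apply: eq_integral => x _.
  rewrite patchE; case: ifPn => //; rewrite notin_setE/= in_itv/= andbT => /negP.
  by rewrite -leNgt => /fN ->.
have cvgF : (\int[lebesgue_measure]_(x in F n) (f x)%:E @[n --> \oo]
    --> \int[lebesgue_measure]_(x in \bigcup_n F n) (f x)%:E)%E.
  apply: ge0_nondecreasing_set_cvg_integral => //.
  - apply/nondecreasing_seqP => n; apply/subsetPset; apply: subset_itv;
      by rewrite bnd_simp ler_expR ?lerN2 ler_nat.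
  - by move=> n; exact/measurable_EFinP/measurable_funTS.
  - by move=> n x _; rewrite lee_fin.
apply: (@le_lt_trans _ _ (4 * M / c)%:E); last exact: ltry.
apply: (cvge_le _ cvgF); apply: nearW => n.
have nn : expR (- n.+1%:R) < expR n.+1%:R :> R by rewrite ltr_expR gtrN.
apply: (@le_trans _ _
  (\int[lebesgue_measure]_(x in F n) (x^-1 * dphi (ln x))%:E)%E).
  apply: ge0_le_integral => //.
  - exact: mF.
  - by move=> x _; rewrite lee_fin.
  - exact/measurable_EFinP/measurable_funTS.
  - apply/measurable_EFinP.
    apply: subspace_continuous_measurable_fun => //.
    by apply: within_continuous_inv_comp_ln; first exact: expR_gt0.
  - move=> x; rewrite /F/= in_itv/= => /andP[ux _].
    have x0 : 0 < x by rewrite (lt_le_trans _ ux) ?expR_gt0.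
    rewrite lee_fin (le_trans (fM x x0))// mulrCA ler_pM2l ?invr_gt0//.
rewrite (integral_inv_comp_ln (expR_gt0 _) nn phiE cdphi) !expRK lee_fin /phi.
(* What remains is [4 M / c] times a difference of two inverses in [[0, 1]]. *)
rewrite !mulNr opprK addrC -mulrBr ler_piMr//.
  by rewrite divr_ge0 ?mulr_ge0// ltW.
rewrite lerBlDr -[leLHS]addr0 lerD//.
by rewrite invf_le1// lerDl expR_ge0.
Qed.

(** * Growth comparisons for the exponents *)

Lemma powR_dominated (R : realType) (a b p q : R) :
  0 < a -> 0 < b -> p < q -> 0 <= p ->
  exists C : R, forall z : R, 0 <= z -> a * z `^ p <= b * z `^ q + C.
Proof.
(* [M] is the crossing point, [a M^p = b M^q]: up to [M] the constant [a M^p] suffices, beyond it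
   the higher power wins. *)
move=> a0 b0 pq p0; set M := (a / b) `^ (q - p)^-1.
have M0 : 0 <= M by exact: powR_ge0.
exists (a * M `^ p) => z z0.
have [zM|Mz] := leP z M.
  apply: (@le_trans _ _ (a * M `^ p)).
    by rewrite ler_pM2l// ge0_ler_powR// nnegrE.
  by rewrite lerDr mulr_ge0 ?powR_ge0// ltW.
apply: (@le_trans _ _ (b * z `^ q)); last first.
  by rewrite lerDl mulr_ge0 ?powR_ge0// ltW.
have z_gt0 : 0 < z by exact: le_lt_trans Mz.
have qp0 : q - p != 0 by rewrite subr_eq0 gt_eqF.
have -> : z `^ q = z `^ (q - p) * z `^ p.
  by rewrite -powRD ?subrK// (gt_eqF z_gt0) implybT.
rewrite mulrA ler_pM2r ?powR_gt0//.
have -> : a = b * M `^ (q - p).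
  rewrite /M -powRrM mulVf// powRr1 ?divr_ge0 ?ltW//.
  by rewrite mulrC divfK// gt_eqF.
by rewrite ler_pM2l// ge0_ler_powR ?nnegrE ?subr_ge0// ltW.
Qed.

(** From [ln w <= w] at [w = z / (2 r)], multiplied by [r] and exponentiated. Only [exp (z / 2)] is
    spent, so that its square can absorb it later. *)
Lemma powR_dominated_expR (R : realType) (r z : R) : 0 < r -> 0 <= z ->
  z `^ r <= (2 * r) `^ r * expR (z / 2).
Proof.
move=> r0; rewrite le_eqVlt => /predU1P[<-|z0].
  by rewrite powR0 ?gt_eqF// mulr_ge0 ?powR_ge0 ?expR_ge0.
have r20 : 0 < 2 * r by rewrite mulr_gt0.
have w0 : 0 < z / (2 * r) by rewrite divr_gt0.
have zE : 2 * r * (z / (2 * r)) = z by rewrite mulrC divfK// gt_eqF.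
have -> : z / 2 = r * (z / (2 * r)) by field; rewrite gt_eqF.
rewrite -[X in X `^ r]zE (powRM _ (ltW r20) (ltW w0)) ler_pM2l ?powR_gt0//.
rewrite /powR gt_eqF// ler_expR ler_pM2l//.
by apply: ltW; exact: ln_sublinear.
Qed.

Lemma powR_norm_dominated_expR (R : realType) (t b m r : R) :
  0 < t -> 0 < b -> 0 < r ->
  exists C : R, forall y : R, 0 <= y -> b * `|y - m| `^ r <= t * expR y + C.
Proof.
(* [B] collects [b], the constant of [powR_dominated_expR], and the cost of [|y - m| <= y + |m|]. *)
move=> t0 b0 r0; set B := b * (2 * r) `^ r * expR (`|m| / 2).
exists (B ^+ 2 / (4 * t)) => y y0.
apply: (@le_trans _ _ (B * expR (y / 2))).
  rewrite /B -!mulrA ler_pM2l// -expRD.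
  apply: (le_trans (powR_dominated_expR _ (normr_ge0 _))) => //.
  rewrite ler_wpM2l ?powR_ge0// ler_expR -mulrDl ler_pM2r ?invr_gt0//.
  by rewrite (le_trans (ler_normB _ _))// ger0_norm// addrC.
have -> : expR y = expR (y / 2) ^+ 2 by rewrite -expRM_natr; congr expR; field.
rewrite -subr_ge0; set s := expR _.
(* AM-GM: [B s <= t s^2 + B^2 / (4 t)] *)
have -> : t * s ^+ 2 + B ^+ 2 / (4 * t) - B * s = t * (s - B / (2 * t)) ^+ 2.
  by field; rewrite gt_eqF.
by rewrite mulr_ge0 ?sqr_ge0// ltW.
Qed.

(** On this half-line [k y = |k| |y|], so it suffices to compare [b z^r] with [|k| z] at
    [z = |y - m|]; the shift costs [|k| |m|]. *)
Lemma powR_norm_dominated_linear (R : realType) (k b m r : R) :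
  0 < b -> 0 < r -> r < 1 \/ (r = 1 /\ b <= `|k|) -> k != 0 ->
  exists C : R, forall y : R, 0 <= k * y -> b * `|y - m| `^ r <= k * y + C.
Proof.
move=> b0 r0 hr k0; have nk0 : 0 < `|k| by rewrite normr_gt0.
have [C hC] : exists C, forall z, 0 <= z -> b * z `^ r <= `|k| * z + C.
  case: hr => [r1|[-> bk]].
    have [C hC] := powR_dominated b0 nk0 r1 (ltW r0).
    by exists C => z z0; have := hC z z0; rewrite powRr1.
  by exists 0 => z z0; rewrite addr0 powRr1// ler_wpM2r.
exists (`|k| * `|m| + C) => y ky0.
apply: (le_trans (hC _ (normr_ge0 _))).
rewrite addrA lerD2r -[k * y]ger0_norm// normrM -mulrDr ler_pM2l//.
exact: ler_normB.
Qed.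

Lemma linear_dominated_powR_norm (R : realType) (k b m r : R) :
  0 < b -> 1 < r \/ (r = 1 /\ `|k| < b) ->
  exists2 c : R, 0 < c & exists C : R,
    forall y : R, k * y - b * `|y - m| `^ r <= C - c * `|y|.
Proof.
move=> b0 hr.
(* The spare slope [c] gives the decay: it is 1 if [1 < r], and the gap [b - |k|] if [r = 1]. *)
have [c c0 [C hC]] : exists2 c, 0 < c & exists C, forall z, 0 <= z ->
    (`|k| + c) * z <= b * z `^ r + C.
  case: hr => [r1|[-> kb]].
    have k1 : 0 < `|k| + 1 by rewrite ltr_wpDl.
    have [C hC] := powR_dominated k1 b0 r1 ler01.
    by exists 1 => //; exists C => z z0; have := hC z z0; rewrite powRr1.
  exists (b - `|k|); first by rewrite subr_gt0.
  by exists 0 => z z0; rewrite addr0 powRr1// subrKC.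
exists c => //; exists (C + (`|k| + c) * `|m|) => y.
have kc : 0 <= `|k| + c by rewrite addr_ge0// ltW.
have h1 := hC _ (normr_ge0 (y - m)).
have h2 : k * y <= `|k| * `|y| by rewrite -normrM ler_norm.
have h3 : `|y| <= `|y - m| + `|m| by rewrite -[X in `|X| <= _](subrK m) ler_normD.
have := ler_wpM2l kc h3; rewrite mulrDr mulrDl.
by move: h1; rewrite !mulrDl; lra.
Qed.

(** * The density and expectations under it *)

Lemma measurable_gln_pdf (R : realType) (mu sigma r : R) :
  measurable_fun [set: R] (gln_pdf mu sigma r).
Proof.
have -> : gln_pdf mu sigma r =
    (fun x => if 0 < x then
      x `^ (- 1) * (fun y => 1 / (2 * r `^ (1 / r) * sigma * Gamma (1 + 1 / r)) *
        expR (- (1 / (r * sigma `^ r)) * `|y - mu| `^ r)) (ln x) else 0).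
  apply/funext => x; rewrite /gln_pdf; case: ifP => // x0.
  set G := Gamma _; set A := r `^ _.
  have -> : 2 * x * A * sigma * G = x * (2 * A * sigma * G) by ring.
  by rewrite powR_inv1 ?ltW// !mul1r invfM mulrA.
apply: measurable_fun_ifT => //; first exact: measurable_fun_ltr.
apply: measurable_funM; first exact: measurable_powR.
apply: measurable_funM => //; apply: measurableT_comp => //.
apply: measurable_funM => //.
apply: (measurableT_comp (measurable_powR r)).
apply: measurableT_comp => //; exact: measurable_funB.
Qed.

Lemma Gamma_ge0 (R : realType) (a : R) : 0 <= Gamma a.
Proof.
apply: Rintegral_ge0 => x _.
by rewrite mulr_ge0 ?powR_ge0 ?expR_ge0.
Qed.

Section gln_distribution.
Context (R : realType) (mu sigma r : R).
Hypotheses (sigma_gt0 : 0 < sigma) (r_gt0 : 0 < r).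

Let b : R := 1 / (r * sigma `^ r).
Let K : R := 1 / (2 * r `^ (1 / r) * sigma * Gamma (1 + 1 / r)).

Let b_gt0 : 0 < b.
Proof. by rewrite divr_gt0// mulr_gt0// powR_gt0. Qed.

Let K_ge0 : 0 <= K.
Proof.
by rewrite /K divr_ge0// !mulr_ge0 ?powR_ge0 ?Gamma_ge0// ltW.
Qed.

Lemma gln_pdfE (x : R) : 0 < x ->
  gln_pdf mu sigma r x = K * (x^-1 * expR (- (b * `|ln x - mu| `^ r))).
Proof.
move=> x0; rewrite /gln_pdf x0 mulNr mulrA; congr (_ * expR _).
rewrite /K; set G := Gamma _; set A := r `^ _.
have -> : 2 * x * A * sigma * G = x * (2 * A * sigma * G) by ring.
by rewrite !mul1r invfM mulrC.
Qed.

Lemma gln_pdf_ge0 (x : R) : 0 <= gln_pdf mu sigma r x.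
Proof.
have [x0|x0] := ltP 0 x.
  rewrite gln_pdfE//; apply: mulr_ge0 => //.
  by apply: mulr_ge0; rewrite ?expR_ge0 ?invr_ge0 ?ltW.
by rewrite /gln_pdf ltNge x0.
Qed.

Lemma gln_pdf_le0 (x : R) : x <= 0 -> gln_pdf mu sigma r x = 0.
Proof. by move=> x0; rewrite /gln_pdf ltNge x0. Qed.

Context (d : measure_display) (T : measurableType d) (P : probability T R).
Context (X : {RV P >-> R}).
Hypothesis X_gln : has_gln_distribution X mu sigma r.

(* No convergence of Euler's integral is needed: if it had its junk value 0,
   the density would vanish as well, against the total mass 1. *)
Let K_gt0 : 0 < K.
Proof.
rewrite lt_neqAle K_ge0 andbT; apply/eqP => K0.
have PT : distribution P X [set: R] = 1%:E.
  by rewrite /distribution /pushforward preimage_setT probability_setT.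
have := X_gln measurableT; rewrite PT.
rewrite /gln_prob integral0_eq; last first.
  move=> x _; have [x0|x0] := ltP 0 x; last by rewrite gln_pdf_le0.
  by rewrite gln_pdfE// -K0 mul0r.
by move=> [] /eqP; rewrite oner_eq0.
Qed.

Lemma integral_comp_gln (g : R -> R) :
  measurable_fun [set: R] g -> (forall x, 0 <= g x) ->
  (\int[P]_w (g (X w))%:E =
   \int[lebesgue_measure]_x (g x * gln_pdf mu sigma r x)%:E)%E.
Proof.
move=> mg g0.
(* [lebesgue_measure] lives on [measurableTypeR R], which has the same
   measurable sets as [R] but another display. *)
have mX : measurable_fun [set: T] (X : T -> measurableTypeR R).
  exact: (measurable_funPT X).
pose Xmixin := isMeasurableFun.Build _ _ _ _ _ mX.
pose Y : {mfun T >-> measurableTypeR R} :=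
  HB.pack (X : T -> measurableTypeR R) Xmixin.
transitivity (\int[distribution P Y]_x (g x)%:E)%E.
  by rewrite ge0_integral_distribution//; exact/measurable_EFinP.
under [RHS]eq_integral do rewrite EFinM.
apply: (@ge0_integral_density _ (measurableTypeR R) R (distribution P Y)
  lebesgue_measure _ (measurable_gln_pdf mu sigma r) gln_pdf_ge0 X_gln
  (EFin \o g)).
- exact/measurable_EFinP.
- by move=> x; rewrite lee_fin.
Qed.

(** If [g (e^y)] offsets the decay [exp (- b |y - mu|^r)] up to the factor [e^(-C)], the integrand
    is at least [K e^(-C) / x] on the half-line chosen by [s]. *)
Lemma integral_comp_gln_infty (s C : R) (g : R -> R) :
  s != 0 -> measurable_fun [set: R] g -> (forall x, 0 <= g x) ->
  (forall y, 0 <= s * y -> expR (b * `|y - mu| `^ r - C) <= g (expR y)) ->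
  (\int[P]_w (g (X w))%:E = +oo)%E.
Proof.
move=> s0 mg g0 gE; rewrite integral_comp_gln//.
apply: (@integral_ge_inv_infty _ s (K * expR (- C))) => //.
- by rewrite mulr_gt0 ?expR_gt0.
- by apply: measurable_funM => //; exact: measurable_gln_pdf.
- by move=> x; rewrite mulr_ge0// gln_pdf_ge0.
- move=> x x0 sx; rewrite gln_pdfE// (mulrCA (g x)) -mulrA ler_pM2l//.
  rewrite (mulrCA (g x)) (mulrC (expR _)) ler_pM2l ?invr_gt0//.
  rewrite -ler_pdivrMr ?expR_gt0// -expRN opprK -expRD addrC.
  by have := gE (ln x) sx; rewrite lnK.
Qed.

(** * Moments and the moment-generating function *)

Lemma moment_infty (k : R) : k != 0 -> r < 1 \/ (r = 1 /\ b <= `|k|) ->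
  ~ moment_exists X k.
Proof.
move=> k0 hr; have [C hC] := powR_norm_dominated_linear mu b_gt0 r_gt0 hr k0.
rewrite /moment_exists unlock.
rewrite (@integral_comp_gln_infty k C (fun x => x `^ k))//.
  by move=> x; exact: powR_ge0.
by move=> y ky; rewrite -expRM ler_expR lerBlDr (mulrC y); exact: hC.
Qed.

Lemma moment_lty (k : R) : 1 < r \/ (r = 1 /\ `|k| < b) -> moment_exists X k.
Proof.
move=> hr; have [c c0 [C hC]] := linear_dominated_powR_norm mu b_gt0 hr.
rewrite /moment_exists unlock ge0_fin_numE; last first.
  by apply: integral_ge0 => w _; rewrite lee_fin powR_ge0.
rewrite (@integral_comp_gln (fun x => x `^ k))//; last first.
  by move=> x; exact: powR_ge0.
apply: (@integral_le_exp_lt_infty _ c (K * expR C)) => //.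
- by apply: measurable_funM => //; exact: measurable_gln_pdf.
- by move=> x; rewrite mulr_ge0 ?powR_ge0 ?gln_pdf_ge0.
- by move=> x x0; rewrite gln_pdf_le0 ?mulr0.
- move=> x x0; rewrite gln_pdfE// mulrCA -mulrA ler_pM2l// mulrCA [leRHS]mulrCA.
  rewrite ler_pM2l ?invr_gt0// /powR gt_eqF// -!expRD ler_expR.
  exact: hC.
Qed.

(** Every neighbourhood of 0 contains some [t > 0], so this excludes the generating function. Large
    [x] cause the divergence, hence [s = 1]. *)
Lemma mgf_infty (t : R) : 0 < t -> 'M_P X t = +oo%E.
Proof.
move=> t0; have [C hC] := powR_norm_dominated_expR mu t0 b_gt0 r_gt0.
rewrite /mmt_gen_fun unlock.
transitivity (\int[P]_w (expR (t * X w))%:E)%E.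
  by apply: eq_integral => w _ /=; rewrite mulrC.
apply: (@integral_comp_gln_infty 1 C (fun x => expR (t * x))) => //.
- by apply: measurableT_comp => //; exact: measurable_funM.
- by move=> y; rewrite mul1r ler_expR lerBlDr; exact: hC.
Qed.

End gln_distribution.

Unset Implicit Arguments.

Theorem proposition1 (R : realType) (d : measure_display)
    (T : measurableType d) (P : probability T R) (X : {RV P >-> R})
    (mu sigma r : R) (sigma_gt0 : 0 < sigma) (r_gt0 : 0 < r)
    (X_gln : has_gln_distribution X mu sigma r) :
  ~ mgf_exists X /\
  (forall k : R,
    [/\ r < 1 -> (moment_exists X k <-> k = 0),
        r = 1 -> (moment_exists X k <-> `|k| < 1 / sigma)
      & 1 < r -> moment_exists X k]).
Proof.
split.
  move=> [t0 t00 /(_ (t0 / 2))].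
  have t20 : 0 < t0 / 2 by rewrite divr_gt0.
  rewrite (mgf_infty sigma_gt0 r_gt0 X_gln t20) => /(_ _)/negP; apply => //.
  rewrite gtr0_norm// ltr_pdivrMr// ltr_pMr// ltr1n//.
move=> k; split.
- move=> r1; split; last first.
    (* The zeroth power is 1 at every base, nonpositive ones included, so the expectation is that of
       a constant. *)
    by move=> ->; rewrite /moment_exists; under eq_fun do rewrite powRr0;
      rewrite expectation_cst.
  move=> mk; apply/eqP; apply: contraPT mk => k0.
  by apply: (moment_infty sigma_gt0 r_gt0 X_gln k0); left.
- move=> r1; have bE : 1 / (r * sigma `^ r) = 1 / sigma.
    by rewrite r1 (mul1r (_ `^ _)) powRr1 ?ltW.
  split.
    move=> mk; rewrite ltNge -bE; apply/negP => bk.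
    apply: (moment_infty sigma_gt0 r_gt0 X_gln _ _ mk); last by right.
    (* [k] is nonzero because [0 < 1 / sigma <= |k|]. *)
    rewrite -normr_gt0 (lt_le_trans _ bk)// bE divr_gt0//.
  by move=> ks; apply: (moment_lty sigma_gt0 r_gt0 X_gln); right; rewrite bE.
- by move=> r1; apply: (moment_lty sigma_gt0 r_gt0 X_gln); left.
Qed.
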